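(* Let $G_S$ be a pseudo-connected self-loop graph of order $N$ with $|S|\ge1$, and let $\widetilde G$ be its Açıkmeşe lift. Let $\nu_1,\dots,\nu_N$ be the positive eigenvalues (with multiplicity) of $M_{sym}$, and let $\lambda_1,\dots,\lambda_N$ be the eigenvalues (with multiplicity) of $\mathcal{L}(G_S)$. Then $$\mathcal{I}_{eq}(\widetilde G)=\sum_{j=1}^N\frac1{\nu_j}-\sum_{i=1}^N\frac1{\lambda_i}.$$ Equivalently, $$\mathcal{I}_{eq}(\widetilde G)=\mathrm{Tr}(M_{sym}^\dagger)-\mathrm{Tr}(\mathcal{L}(G_S)^{-1}),$$ where $M_{sym}^\dagger$ denotes the Moore–Penrose inverse of $M_{sym}$.
   Context: Let $G$ be a finite undirected simple graph with vertex set $V=\{1,\dots,N\}$, and $S\subseteq V$. The self-loop graph $G_S$ is obtained from $G$ by attaching one loop at every vertex of $S$; $\sigma=|S|$. $G_S$ is pseudo-connected if every connected component contains at least one looped vertex. The loop vector $s\in\mathbb{R}^N$ is the indicator vector of $S$. $\mathcal{L}(G)=D(G)-A(G)$ is the ordinary Laplacian and $\mathcal{L}(G_S):=\mathcal{L}(G)+\mathrm{diag}(s)$. When $G_S$ is pseudo-connected, $\mathcal{L}(G_S)$ is positive definite, the lift below is connected, and $M_{sym}$ is positive semidefinite with exactly one zero eigenvalue. For $\sigma\ge1$, the Açıkmeşe lift $\widetilde G=(\widetilde V,\widetilde E)$ of $G_S$ is the simple graph on $\widetilde V=\{1,\dots,2N+1\}$ such that: for each edge $\{i,j\}$ of $G$,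 both $\{i,j\}$ and $\{i+N+1,j+N+1\}$ are edges of $\widetilde G$; for each $i\in S$, both $\{i,N+1\}$ and $\{N+1,i+N+1\}$ are edges; there are no other edges. $\mathcal{L}(\widetilde G)$ is the ordinary Laplacian of $\widetilde G$. The involution matrix $T$ is the $(2N+1)\times(2N+1)$ permutation matrix of the map swapping $i\leftrightarrow i+N+1$ ($1\le i\le N$) and fixing $N+1$. For the nontrivial element $g$ of $\mathbb{Z}_2$, $\chi_t^{\widetilde G}(g)=\mathrm{Tr}(e^{-t\mathcal{L}(\widetilde G)}T)$, $t>0$. The regularized equivariant heat integral is $\mathcal{I}_{eq}(\widetilde G)=\int_0^\infty(\chi_t^{\widetilde G}(g)-1)\,dt$. $M_{sym}=\begin{pmatrix}2\sigma&-\sqrt2\,s^\top\\ -\sqrt2\,s&\mathcal{L}(G_S)\end{pmatrix}\in\mathbb{R}^{(N+1)\times(N+1)}$. *)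

(* Defs.v *)
From HB Require Import structures.
From mathcomp Require Import all_boot all_order all_algebra all_fingroup.
From mathcomp Require Import all_classical all_reals all_analysis.

Set Implicit Arguments.
Unset Strict Implicit.
Unset Printing Implicit Defensive.

Import Order.TTheory GRing.Theory Num.Theory numFieldNormedType.Exports.

Local Open Scope ring_scope.

Record sgraph (n : nat) := SGraph {
  adj :> rel 'I_n;
  adj_sym : symmetric adj;
  adj_irrefl : irreflexive adj
}.

Definition adjacency (R : pzRingType) n (G : sgraph n) : 'M[R]_n :=
  \matrix_(i, j) (G i j)%:R.

Definition degree_mx (R : pzRingType) n (G : sgraph n) : 'M[R]_n :=
  diag_mx (\row_i #|[pred j | G i j]|%:R).

Definition laplacian (R : pzRingType) n (G : sgraph n) : 'M[R]_n :=
  degree_mx R G - adjacency R G.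

(* The self-loop graph G_S is represented by the pair (G, S). *)
Definition pseudo_connected n (G : sgraph n) (S : {set 'I_n}) : Prop :=
  forall i : 'I_n, exists2 j : 'I_n, j \in S & connect G i j.

Definition loop_vector (R : pzRingType) n (S : {set 'I_n}) : 'cV[R]_n :=
  \col_i (i \in S)%:R.

Definition loop_laplacian (R : pzRingType) n (G : sgraph n) (S : {set 'I_n}) :
  'M[R]_n := laplacian R G + diag_mx (loop_vector R S)^T.

Section Lift.
Variable n : nat.

(* Zero-based, the vertices 1..N, N+1 and N+2..2N+1 of the lift are the *)
(* numbers i, N and N + 1 + i, with i : 'I_N.                           *)
Definition copy1 (i : 'I_n) : 'I_(n + (1 + n)) := lshift (1 + n) i.
Definition midv : 'I_(n + (1 + n)) := rshift n (lshift n ord0).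
Definition copy2 (i : 'I_n) : 'I_(n + (1 + n)) := rshift n (rshift 1 i).

Definition link (u v a b : 'I_(n + (1 + n))) : bool :=
  (u == a) && (v == b) || (u == b) && (v == a).

Definition lift_adj (G : sgraph n) (S : {set 'I_n}) : rel 'I_(n + (1 + n)) :=
  fun u v =>
    [exists i, exists j, G i j &&
       (link u v (copy1 i) (copy1 j) || link u v (copy2 i) (copy2 j))]
    || [exists i in S, link u v (copy1 i) midv || link u v midv (copy2 i)].

Lemma link_sym u v a b : link u v a b = link v u a b.
Proof. by rewrite /link orbC andbC [X in _ || X]andbC. Qed.

Lemma lift_adj_sym G S : symmetric (lift_adj G S).
Proof.
move=> u v; rewrite /lift_adj; congr (_ || _).
  by do 2!(apply: eq_existsb => ?); rewrite !(link_sym u).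
by apply: eq_existsb => i; rewrite !(link_sym u).
Qed.

Lemma link_diag u a b : link u u a b -> a = b.
Proof. by case/orP=> /andP[/eqP <- /eqP <-]. Qed.

Lemma lift_adj_irrefl G S : irreflexive (lift_adj G S).
Proof.
move=> u; apply/negP; case/orP.
  case/existsP=> i /existsP[j] /andP[Gij].
  by case/orP=> /link_diag => [/lshift_inj|/rshift_inj/rshift_inj] eij;
     move: Gij; rewrite eij adj_irrefl.
case/existsP=> i /andP[_] /orP[] /link_diag /eqP.
  by rewrite eq_lrshift.
by move/eqP/rshift_inj/eqP; rewrite eq_lrshift.
Qed.

Definition acikmese_lift (G : sgraph n) (S : {set 'I_n}) :
  sgraph (n + (1 + n)) := SGraph (lift_adj_sym G S) (lift_adj_irrefl G S).

Definition swap_fun (u : 'I_(n + (1 + n))) : 'I_(n + (1 + n)) :=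
  match fintype.split u with
  | inl i => copy2 i
  | inr u' => match fintype.split u' with inl _ => midv | inr i => copy1 i end
  end.

Lemma swap_funK : involutive swap_fun.
Proof.
have s1 i : fintype.split (copy1 i) = inl i by rewrite (unsplitK (inl i)).
have s2 (i : 'I_(1 + n)) : fintype.split (rshift n i) = inr i.
  by rewrite (unsplitK (inr i)).
have s3 (i : 'I_n) : fintype.split (rshift 1 i) = inr i by rewrite (unsplitK (inr i)).
have s4 : fintype.split (lshift n (ord0 : 'I_1)) = inl ord0.
  by rewrite (unsplitK (inl ord0)).
move=> u; rewrite -(fintype.splitK u) /swap_fun.
case: (fintype.split u) => [i|u'] /=; first by rewrite s1 s2 s3.
rewrite s2 -(fintype.splitK u'); case: (fintype.split u') => [k|i] /=.
  by rewrite (ord1 k) s4 s2 s4.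
by rewrite s3 s1.
Qed.

Definition swap_perm : 'S_(n + (1 + n)) := perm (can_inj swap_funK).

Definition involution_mx (R : pzRingType) : 'M[R]_(n + (1 + n)) :=
  perm_mx swap_perm.

End Lift.

Definition expmx (R : realType) n (A : 'M[R]_n) : 'M[R]_n :=
  limn (series (fun k => (k`!%:R)^-1 *: A ^+ k)).

Definition equivariant_heat_trace (R : realType) n (G : sgraph n)
    (S : {set 'I_n}) (t : R) : R :=
  \tr (expmx (- t *: laplacian R (acikmese_lift G S)) *m involution_mx n R).

(* Lebesgue integral, with values in \bar R: it can only be equal to a *)
(* real number when the integrand is integrable.                       *)
Definition heat_integral (R : realType) n (G : sgraph n) (S : {set 'I_n}) :
  \bar R :=
  (\int[lebesgue_measure]_(t in `]0%R, +oo[%classic)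
     (equivariant_heat_trace G S t - 1)%:E)%E.

Definition Msym (R : realType) n (G : sgraph n) (S : {set 'I_n}) :
  'M[R]_(1 + n) :=
  block_mx (2 * #|S|%:R)%:M (- Num.sqrt 2 *: (loop_vector R S)^T)
           (- Num.sqrt 2 *: loop_vector R S) (loop_laplacian R G S).

(* s lists the (real) eigenvalues of A selected by P, each repeated *)
(* according to its algebraic multiplicity.                         *)
Definition lists_eigenvalues (R : realType) n (A : 'M[R]_n) (P : pred R)
    (s : seq R) : Prop :=
  forall x : R, count_mem x s = if P x then mup x (char_poly A) else 0%N.

(* The Penrose conditions for real matrices. *)
Definition is_moore_penrose (R : realType) m n (A : 'M[R]_(m, n))
    (X : 'M[R]_(n, m)) : Prop :=
  [/\ A *m X *m A = A, X *m A *m X = X,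
      (A *m X)^T = A *m X & (X *m A)^T = X *m A].

Definition moore_penrose (R : realType) m n (A : 'M[R]_(m, n)) :
  'M[R]_(n, m) :=
  xget 0 (is_moore_penrose A).

Section MoorePenrose.
Variable R : realType.

Lemma gram_eq0 n (u : 'rV[R]_n) : u *m u^T = 0 -> u = 0.
Proof.
move/matrixP/(_ 0 0); rewrite !mxE => /eqP.
rewrite psumr_eq0 => [/allP u0|i _]; last by rewrite mxE -expr2 sqr_ge0.
apply/rowP=> i; rewrite mxE; apply/eqP.
by move: (u0 i (mem_index_enum i)); rewrite mxE -expr2 sqrf_eq0.
Qed.

Lemma gram_unit m n (B : 'M[R]_(m, n)) : row_free B -> B *m B^T \in unitmx.
Proof.
move=> Bfree; rewrite -row_free_unit -kermx_eq0; apply/eqP/row_matrixP=> i.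
rewrite row0; set u := row i _.
have uB0 : u *m (B *m B^T) = 0.
  by apply/eqP; rewrite -sub_kermx row_sub.
suff: u *m B = 0 by move/eqP; rewrite mulmx_free_eq0 // => /eqP.
by apply: gram_eq0; rewrite trmx_mul mulmxA -(mulmxA u) uB0 mul0mx.
Qed.

Lemma moore_penrose_exists m n (A : 'M[R]_(m, n)) :
  exists X, is_moore_penrose A X.
Proof.
suff: exists X, is_moore_penrose (col_base A *m row_base A) X.
  by rewrite mulmx_base.
have : row_free (col_base A)^T.
  by rewrite /row_free mxrank_tr; exact: col_base_full.
move=> /gram_unit; have := gram_unit (row_base_free A); rewrite trmxK.
move: (col_base A) (row_base A) => C B uB uC.
set Bi := invmx (B *m B^T); set Ci := invmx (C^T *m C).
have BBi : B *m B^T *m Bi = 1%:M by rewrite mulmxV.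
have CiC : Ci *m (C^T *m C) = 1%:M by rewrite mulVmx.
have tBi : Bi^T = Bi by rewrite trmx_inv trmx_mul trmxK.
have tCi : Ci^T = Ci by rewrite trmx_inv trmx_mul trmxK.
pose X := B^T *m Bi *m (Ci *m C^T).
have AX : C *m B *m X = C *m Ci *m C^T.
  by rewrite /X !mulmxA -(mulmxA C B) -(mulmxA C _ Bi) BBi mulmx1.
have XA : X *m (C *m B) = B^T *m Bi *m B.
  by rewrite /X -!mulmxA (mulmxA C^T) (mulmxA Ci) CiC mul1mx.
exists X; split.
- by rewrite AX -!mulmxA (mulmxA C^T) (mulmxA Ci) CiC mul1mx.
- rewrite XA /X !mulmxA -(mulmxA (B^T *m Bi) B) -(mulmxA _ (B *m B^T) Bi).
  by rewrite BBi mulmx1.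
- by rewrite AX !trmx_mul trmxK tCi mulmxA.
- by rewrite XA !trmx_mul trmxK tBi mulmxA.
Qed.

Lemma moore_penroseP m n (A : 'M[R]_(m, n)) :
  is_moore_penrose A (moore_penrose A).
Proof. by rewrite /moore_penrose; exact: (xgetPex 0 (moore_penrose_exists A)). Qed.

Lemma moore_penrose_unique m n (A : 'M[R]_(m, n)) X Y :
  is_moore_penrose A X -> is_moore_penrose A Y -> X = Y.
Proof.
move=> [AXA XAX tAX tXA] [AYA YAY tAY tYA].
have eAX : A *m X = A *m Y.
  rewrite -tAX -{1}AYA -(mulmxA _ A X) trmx_mul tAX tAY.
  by rewrite mulmxA AXA.
have eXA : X *m A = Y *m A.
  rewrite -tXA -{1}AYA -!mulmxA mulmxA trmx_mul tXA tYA.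
  by rewrite -mulmxA (mulmxA A) AXA.
by rewrite -XAX -mulmxA eAX mulmxA eXA YAY.
Qed.

End MoorePenrose.

(* Main.v *)
Require Import Defs.
From HB Require Import structures.
From mathcomp Require Import all_boot all_order all_algebra all_fingroup.
From mathcomp Require Import all_classical all_reals all_analysis.
From mathcomp Require Import spectral complex ring.
Import Order.TTheory GRing.Theory Num.Theory numFieldNormedType.Exports.
Local Open Scope ring_scope.

Set Implicit Arguments.
Unset Strict Implicit.
Unset Printing Implicit Defensive.

(** The involution of the lift splits functions on its vertices into odd ones
(opposite values on the two copies, zero at the middle vertex) and even ones.
In an orthonormal basis adapted to this splitting, the Laplacian of the lift
becomes block diagonal: [loop_laplacian] on the odd part and [Msym] on the
even part ([parity_lift_laplacian]); the square roots of 2 in [Msym] come from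
normalizing the vectors of the basis.  The involution becomes -1 on the odd
part and 1 on the even part ([parity_involution]).  Hence the equivariant heat
trace is the sum of [exp (- t nu)] over the spectrum of [Msym] minus the sum of
[exp (- t lambda)] over the spectrum of [loop_laplacian]
([equivariant_heat_trace_spectrum]).

The quadratic form of [Msym] at a vector with first coordinate [a] and
remaining coordinates [w] is the Dirichlet energy of [w] plus the sum over the
looped vertices of [(w i - sqrt 2 * a)^2] ([Msym_quadratic]).  It is
nonnegative, and pseudo-connectedness makes it vanish exactly on a line, so
[Msym] has exactly one zero eigenvalue and the others are positive
([Msym_spectrum]).  For the same reason [loop_laplacian] is positive definite.
The zero eigenvalue contributes the constant 1, which the regularization
subtracts; each remaining exponential integrates to the inverse of its rate
([integral_heat_sum]).

The two symmetric matrices enter through diagonalizations over the reals whose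
base changes may fail to be orthogonal.  Such a diagonalization still gives the
trace of the Moore-Penrose inverse: the Moore-Penrose inverse of a symmetric
matrix commutes with it ([moore_penrose_group_inverse]), and a generalized
inverse commuting with the matrix is unique ([group_inverse_unique]) and can be
read off any diagonalization ([trace_group_inverse_diag]). *)

(** * Diagonalization of real symmetric matrices *)

(** Over the complex numbers, a real symmetric matrix is hermitian, so it is
similar to a diagonal matrix with real entries; and real matrices that are
similar over the complex numbers are similar over the reals. *)
Lemma symmetric_diagonalizable (R : rcfType) n (A : 'M[R]_n) : A^T = A ->
  exists P : 'M[R]_n, exists2 d : 'rV[R]_n,
    P \in unitmx & A = invmx P *m diag_mx d *m P.
Proof.
move=> symA; pose f : {rmorphism R -> R[i]} := real_complex R.
pose C : 'M[R[i]]_n := map_mx f A.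
have realf m p (B : 'M[R]_(m, p)) : map_mx f B \is a mxOver Num.real.
  by apply/mxOverP => i j; rewrite mxE; apply/complex_realP; eexists.
have hermC : C \is hermsymmx.
  apply: realsym_hermsym; last exact: realf.
  apply/is_hermitianmxP; rewrite expr0 scale1r.
  by rewrite map_mx_id // /C map_trmx symA.
have /orthomx_spectralP spC := hermitian_normalmx hermC.
have /mxOverP real_sp := hermitian_spectral_diag_real hermC.
pose d := map_mx (@complex.Re R) (spectral_diag C).
have fd : map_mx f d = spectral_diag C.
  by apply/matrixP => i j; rewrite !mxE; exact: (RRe_real (real_sp i j)).
have [] := @real_similar _ n C (map_mx f (diag_mx d)).
- exists (spectralmx C); first exact: spectral_unit.
  apply/similarP; first exact: spectral_unit.
  rewrite map_diag_mx fd {2}spC !mulmxA mulmxV ?mul1mx //.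
  exact: spectral_unit.
- exact: realf.
- exact: realf.
move=> P; rewrite inE => /andP[/mxOverP realP Punit] /(similarP Punit) simP.
pose Q := map_mx (@complex.Re R) P.
have fQ : map_mx f Q = P.
  by apply/matrixP => i j; rewrite !mxE; exact: (RRe_real (realP i j)).
have Qunit : Q \in unitmx by rewrite -(map_unitmx f) fQ.
exists Q, d => //; rewrite -mulmxA; apply: (canRL (mulKmx Qunit)).
by apply: (@map_mx_inj _ _ f); rewrite !map_mxM fQ.
Qed.

(** * Spectra and generalized inverses of diagonalized matrices *)

Lemma char_poly_similar_diag (F : fieldType) n (A P : 'M[F]_n) (d : 'rV[F]_n) :
  P \in unitmx -> A = invmx P *m diag_mx d *m P ->
  char_poly A = \prod_i ('X - (d 0 i)%:P).
Proof.
move=> Pu ->; pose p := @map_mx _ _ (@polyC F) n n.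
have cpE : char_poly_mx (invmx P *m diag_mx d *m P) =
    p (invmx P) *m char_poly_mx (diag_mx d) *m p P.
  rewrite /char_poly_mx mulmxBr mulmxBl -!map_mxM; congr (_ - _).
  by rewrite -mulmxA -scalar_mxC mulmxA -map_mxM mulVmx // map_mx1 mul1mx.
rewrite /char_poly cpE !det_mulmx mulrC mulrA -det_mulmx -map_mxM mulmxV //.
rewrite map_mx1 det1 mul1r -/(char_poly _) char_poly_trig ?diag_mx_is_trig //.
by apply: eq_bigr => i _; rewrite mxE eqxx.
Qed.

(** The characteristic polynomial of a diagonalized matrix splits over the
diagonal entries, so algebraic multiplicities count repetitions among them. *)
Lemma lists_eigenvalues_diag (R : realType) n (A P : 'M[R]_n) (d : 'rV[R]_n)
    (p : pred R) (s : seq R) :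
  P \in unitmx -> A = invmx P *m diag_mx d *m P -> lists_eigenvalues A p s ->
  perm_eq s [seq x <- [seq d 0 i | i <- enum 'I_n] | p x].
Proof.
move=> Pu eA hs; apply/allP => x _ /=.
rewrite hs (char_poly_similar_diag Pu eA).
have -> : \prod_i ('X - (d 0 i)%:P) =
    \prod_(y <- [seq d 0 i | i <- enum 'I_n]) ('X - y%:P).
  by rewrite big_map big_enum.
rewrite mu_prod_XsubC count_filter; apply/eqP.
case px: (p x).
  by apply: eq_count => y /=; case: eqP => // ->; rewrite px.
rewrite (eq_count (a2 := pred0)) ?count_pred0 // => y /=.
by case: eqP => // ->; rewrite px.
Qed.

Definition group_inverse (F : fieldType) n (A X : 'M[F]_n) :=
  [/\ A *m X *m A = A, X *m A *m X = X & A *m X = X *m A].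

(** Both [A *m X] and [A *m Y] are the projection onto the image of [A] along
its kernel, hence they agree. *)
Lemma group_inverse_unique (F : fieldType) n (A X Y : 'M[F]_n) :
  group_inverse A X -> group_inverse A Y -> X = Y.
Proof.
move=> [AXA XAX cX] [AYA YAY cY].
have eAXY : A *m X = A *m Y.
  by rewrite -{1}AYA -mulmxA cX cY -mulmxA (mulmxA A) AXA.
by rewrite -XAX -mulmxA eAXY mulmxA -cX eAXY cY YAY.
Qed.

(** The transpose of a Moore-Penrose inverse of [A] is one of the transpose of
[A]; by uniqueness it is symmetric when [A] is, and then symmetry of the product
is commutation. *)
Lemma moore_penrose_group_inverse (R : realType) n (A : 'M[R]_n) :
  A^T = A -> group_inverse A (moore_penrose A).
Proof.
move=> symA; have [AXA XAX tAX tXA] := moore_penroseP A.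
set X := moore_penrose A in AXA XAX tAX tXA *.
have AXt : A *m X^T = X *m A by rewrite -{1}symA -trmx_mul tXA.
have XtA : X^T *m A = A *m X by rewrite -{1}symA -trmx_mul tAX.
have symX : X^T = X.
  apply: (@moore_penrose_unique _ _ _ A); last exact: moore_penroseP.
  split.
  - by rewrite -[RHS]symA -[in RHS]AXA !trmx_mul symA mulmxA.
  - by rewrite -[in RHS]XAX !trmx_mul symA mulmxA.
  - by rewrite AXt.
  - by rewrite XtA.
by split=> //; rewrite -tAX trmx_mul symA symX.
Qed.

(** Since [0^-1 = 0], inverting the diagonal entrywise gives the group inverse,
also for singular matrices. *)
Lemma trace_group_inverse_diag (F : fieldType) n (A P X : 'M[F]_n)
    (d : 'rV[F]_n) :
  P \in unitmx -> A = invmx P *m diag_mx d *m P -> group_inverse A X ->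
  \tr X = \sum_i (d 0 i)^-1.
Proof.
move=> Pu eA hX; pose D := diag_mx d; pose E := diag_mx (map_mx GRing.inv d).
have conjM U V : (invmx P *m U *m P) *m (invmx P *m V *m P) =
    invmx P *m (U *m V) *m P.
  by rewrite !mulmxA mulmxK.
suff /(group_inverse_unique hX) -> : group_inverse A (invmx P *m E *m P).
  rewrite mxtrace_mulC mulmxA mulmxV // mul1mx mxtrace_diag.
  by apply: eq_bigr => i _; rewrite mxE.
rewrite eA; split; rewrite !conjM !mulmx_diag; congr (_ *m diag_mx _ *m _).
- apply/rowP => i; rewrite !mxE; have [->|d0] := eqVneq (d 0 i) 0.
    by rewrite mulr0.
  by rewrite mulfV // mul1r.
- apply/rowP => i; rewrite !mxE; have [->|d0] := eqVneq (d 0 i) 0.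
    by rewrite invr0 mulr0.
  by rewrite mulVf // mul1r.
- by apply/rowP => i; rewrite !mxE mulrC.
Qed.

Lemma sum_eigenvalues (R : realType) n (d : 'rV[R]_n) (p : pred R)
    (F : R -> R) s :
  perm_eq s [seq x <- [seq d 0 i | i <- enum 'I_n] | p x] ->
  \sum_(x <- s) F x = \sum_(i | p (d 0 i)) F (d 0 i).
Proof.
by move=> ps; rewrite (perm_big _ ps) big_filter big_map big_enum_cond.
Qed.

Lemma size_eigenvalues (R : realType) n (d : 'rV[R]_n) (p : pred R)
    (s : seq R) :
  perm_eq s [seq x <- [seq d 0 i | i <- enum 'I_n] | p x] ->
  size s = #|[pred i | p (d 0 i)]|.
Proof.
move=> ps; rewrite -sum1_size (perm_big _ ps) big_filter big_map big_enum_cond.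
by rewrite sum1_card.
Qed.

(** * Exponentials of diagonalized matrices *)

Section MatrixExponential.
Local Open Scope classical_set_scope.

Lemma cvg_mx (R : realType) m n (u : nat -> 'M[R]_(m, n)) (M : 'M[R]_(m, n)) :
  (forall i j, (fun k => u k i j) @ \oo --> M i j) -> u @ \oo --> M.
Proof.
move=> uM; apply/cvg_mx_entourageP => E entE.
have : \forall k \near \oo, forall ij : 'I_m * 'I_n,
    (M ij.1 ij.2, u k ij.1 ij.2) \in E.
  apply: filter_forall => -[i j] /=.
  have uE : \forall k \near \oo, E (M i j, u k i j).
    by have /cvg_entourageP/(_ E entE) := uM i j.
  by apply: filterS uE => k /=; rewrite inE.
move=> uE; apply: filterS uE => k uk i j; exact: (uk (i, j)).
Qed.

Lemma mulmx_diag_mxE (R : pzRingType) n (X Y : 'M[R]_n) (d : 'rV[R]_n) i j :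
  (X *m diag_mx d *m Y) i j = \sum_k X i k * d 0 k * Y k j.
Proof.
rewrite mxE; apply: eq_bigr => k _; congr (_ * _).
by rewrite mul_mx_diag mxE.
Qed.

(** The partial sums of the exponential series are themselves of the form
[invmx P *m diag_mx _ *m P], so convergence reduces to that of scalar
exponential series, entry by entry. *)
Lemma expmx_similar_diag (R : realType) n (A P : 'M[R]_n) (d : 'rV[R]_n) :
  P \in unitmx -> A = invmx P *m diag_mx d *m P ->
  expmx A = invmx P *m diag_mx (map_mx expR d) *m P.
Proof.
move=> Pu eA; set M := RHS.
suff cM : (series (fun k => (k`!%:R)^-1 *: A ^+ k) : nat -> 'M[R]_n) @ \oo --> M.
  exact: (cvg_lim (@norm_hausdorff R 'M[R]_n) cM).
have powA k : A ^+ k = invmx P *m diag_mx (map_mx (fun x => x ^+ k) d) *m P.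
  elim: k => [|k IHk].
    rewrite expr0 (_ : map_mx _ _ = const_mx 1).
      by rewrite diag_const_mx mulmx1 mulVmx.
    by apply/rowP => i; rewrite !mxE expr0.
  rewrite exprS IHk {1}eA -mulmxE !mulmxA mulmxK //.
  congr (_ *m _); rewrite -mulmxA mulmx_diag; congr (_ *m diag_mx _).
  by apply/rowP => i; rewrite !mxE exprS.
apply: cvg_mx => i j.
rewrite /M mulmx_diag_mxE.
under eq_fun => k.
  rewrite /series /= summxE.
  under eq_bigr => l _ do rewrite mxE powA mulmx_diag_mxE mulr_sumr.
  rewrite exchange_big /=.
  under eq_bigr => m _.
    rewrite (_ : \sum_(0 <= l < k) _ =
      invmx P i m * series (exp_coeff (d 0 m)) k * P m j); last first.
      rewrite /series /= mulr_sumr mulr_suml; apply: eq_bigr => l _.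
      by rewrite /exp_coeff /= mxE; ring.
    over.
  over.
apply: cvg_big => [|m _]; first exact: add_continuous.
 apply: cvgMl; apply: cvgMr.
rewrite mxE; exact: is_cvg_series_exp_coeff.
Qed.

End MatrixExponential.

(** * Integrals of decaying exponentials *)

Section ExponentialIntegrals.
Local Open Scope classical_set_scope.

(** Multiplied by [x], the integrand is the density of the exponential law of
rate [x], whose total mass is 1. *)
Lemma integral_expR_decay (R : realType) (x : R) : 0 < x ->
  lebesgue_measure.-integrable `]0%R, +oo[ (EFin \o (fun t => expR (- t * x))) /\
  (\int[lebesgue_measure]_(t in `]0%R, +oo[) (expR (- t * x))%:E = (x^-1)%:E)%E.
Proof.
move=> x0; pose mu : {measure set _ -> \bar R} := lebesgue_measure.
have eqf : {in (`]0%R, +oo[ : set R), (fun t => (expR (- t * x))%:E) =1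
    (fun t => (x^-1)%:E * (exponential_pdf x t)%:E)%E}.
  move=> t; rewrite inE /= in_itv /= andbT => t0.
  rewrite exponential_pdfE ?ltW // -EFinM mulrA mulVf ?gt_eqF // mul1r.
  by rewrite mulNr mulNr mulrC.
have int_pdf := integrable_exponential_pdf x0.
have int_pdfT : mu.-integrable `]0%R, +oo[ (EFin \o exponential_pdf x).
  by apply: integrableS int_pdf.
split.
  apply: (@eq_integrable _ _ _ mu _ _
    (fun t => ((x^-1)%:E * (exponential_pdf x t)%:E)%E)) => //.
    by move=> t ht; rewrite /= -eqf.
  exact: integrableZl.
rewrite (@eq_integral _ _ _ mu _
  (fun t => (x^-1)%:E * (exponential_pdf x t)%:E)%E) //.
rewrite integralZl //.
rewrite integral_itv_obnd_cbnd; last exact: measurable_int int_pdfT.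
rewrite [X in (_ * X)%E](_ : _ = 1%E) ?mule1 //.
rewrite -(integral_exponential_pdf x0) integral_mkcond.
apply: eq_integral => t _.
rewrite patchE; case: ifPn => //; rewrite notin_setE /= in_itv /= andbT => /negP.
by rewrite -ltNge => /lt0_exponential_pdf ->.
Qed.

Definition heat_sum (R : realType) (s : seq R) (t : R) : R :=
  \sum_(x <- s) expR (- t * x).

Lemma integral_heat_sum (R : realType) (s : seq R) : all (> 0) s ->
  lebesgue_measure.-integrable `]0%R, +oo[ (EFin \o heat_sum s) /\
  (\int[lebesgue_measure]_(t in `]0%R, +oo[) (heat_sum s t)%:E
    = (\sum_(x <- s) x^-1)%:E)%E.
Proof.
elim: s => [_|x s IHs /= /andP[x0 /IHs[ints eqs]]].
  have -> : heat_sum [::] = cst (0 : R).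
    by apply/funext => t; rewrite /heat_sum big_nil.
  by rewrite big_nil; split; [exact: integrable0|exact: integral0].
have [intx eqx] := integral_expR_decay x0.
have -> : heat_sum (x :: s) = (fun t => expR (- t * x)) \+ heat_sum s.
  by apply/funext => t; rewrite /heat_sum big_cons.
split.
  by apply: (integrableD _ intx ints).
under eq_integral do rewrite EFinD.
by rewrite integralD // eqx eqs big_cons.
Qed.

End ExponentialIntegrals.

(** * Quadratic forms of the Laplacians *)

Section Quadratic.
Variables (R : realType) (n : nat) (G : sgraph n) (S : {set 'I_n}).

Lemma laplacianE i j :
  laplacian R G i j = (i == j)%:R * (\sum_k (G i k)%:R) - (G i j)%:R.
Proof.
rewrite !mxE -[X in X - _]mulr_natl; congr (_ * _ - _).
rewrite -sum1_card natr_sum [LHS]big_mkcond.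
apply: eq_bigr => k _; rewrite inE; by case: (G i k).
Qed.

Lemma mul_laplacian (v : 'rV[R]_n) i :
  (v *m laplacian R G) 0 i = \sum_j (G i j)%:R * (v 0 i - v 0 j).
Proof.
rewrite mxE (eq_bigr (fun j => v 0 j * ((j == i)%:R * \sum_k (G j k)%:R) -
    v 0 j * (G j i)%:R)); last by move=> j _; rewrite laplacianE mulrBr.
rewrite sumrB (bigD1 i) //= eqxx mul1r [X in _ + X - _]big1 ?addr0; last first.
  by move=> j /negPf ->; rewrite mul0r mulr0.
rewrite mulr_sumr -sumrB; apply: eq_bigr => j _.
by rewrite (adj_sym G j) -mulrBl mulrC.
Qed.

(** Each edge is counted twice in the double sum, once per orientation; adding
the two orientations symmetrizes [(v i - v j) * v i] into a square. *)
Lemma laplacian_quadratic (v : 'rV[R]_n) :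
  (v *m laplacian R G *m v^T) 0 0 =
  2^-1 * \sum_i \sum_j (G i j)%:R * (v 0 i - v 0 j) ^+ 2.
Proof.
pose h i j : R := (G i j)%:R * (v 0 i - v 0 j) * v 0 i.
have -> : (v *m laplacian R G *m v^T) 0 0 = \sum_i \sum_j h i j.
  rewrite mxE; apply: eq_bigr => i _; rewrite mul_laplacian mxE mulr_suml.
  by apply: eq_bigr.
have -> : \sum_i \sum_j (G i j)%:R * (v 0 i - v 0 j) ^+ 2 =
    \sum_i \sum_j h i j + \sum_i \sum_j h j i.
  rewrite -big_split; apply: eq_bigr => i _; rewrite -big_split.
  by apply: eq_bigr => j _; rewrite /h (adj_sym G j) /=; ring.
by rewrite [X in _ + X]exchange_big /=; field.
Qed.

Lemma laplacian_quadratic_ge0 (v : 'rV[R]_n) :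
  0 <= (v *m laplacian R G *m v^T) 0 0.
Proof.
rewrite laplacian_quadratic mulr_ge0 ?invr_ge0 // sumr_ge0 // => i _.
by rewrite sumr_ge0 // => j _; rewrite mulr_ge0 ?sqr_ge0.
Qed.

(** A vanishing Dirichlet energy forces equality along every edge, hence along
every path. *)
Lemma laplacian_quadratic_eq0 (v : 'rV[R]_n) :
  (v *m laplacian R G *m v^T) 0 0 = 0 ->
  forall i j, connect G i j -> v 0 i = v 0 j.
Proof.
rewrite laplacian_quadratic => /eqP.
have t0 i j : 0 <= (G i j)%:R * (v 0 i - v 0 j) ^+ 2.
  by rewrite mulr_ge0 ?sqr_ge0.
rewrite mulf_eq0 invr_eq0 pnatr_eq0 /= psumr_eq0 => [/allP q0|i _]; last first.
  exact: sumr_ge0.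
have edge i j : G i j -> v 0 i = v 0 j.
  move=> Gij; apply/eqP; move: (q0 i (mem_index_enum i)) => /=.
  rewrite psumr_eq0 // => /allP/(_ j (mem_index_enum j)) /=.
  by rewrite Gij mul1r sqrf_eq0 subr_eq0.
move=> i j /connectP[p pth ->].
by elim: p i pth => //= k p IHp i /andP[/edge -> /IHp].
Qed.

Lemma quadratic_diag (v : 'rV[R]_n) :
  (v *m diag_mx (loop_vector R S)^T *m v^T) 0 0 = \sum_(i in S) v 0 i ^+ 2.
Proof.
rewrite mxE [RHS]big_mkcond; apply: eq_bigr => i _; rewrite mul_mx_diag !mxE.
by case: (i \in S); rewrite ?mulr1 ?mulr0 ?mul0r // expr2.
Qed.

Lemma loop_quadratic (v : 'rV[R]_n) :
  (v *m loop_laplacian R G S *m v^T) 0 0 =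
  (v *m laplacian R G *m v^T) 0 0 + \sum_(i in S) v 0 i ^+ 2.
Proof. by rewrite mulmxDr mulmxDl mxE quadratic_diag. Qed.

Lemma loop_laplacian_sym : (loop_laplacian R G S)^T = loop_laplacian R G S.
Proof.
rewrite /loop_laplacian /laplacian !raddfD /= raddfN /= !tr_diag_mx.
congr (_ - _ + _); apply/matrixP => i j; rewrite !mxE; congr (_%:R).
by rewrite (adj_sym G).
Qed.

Lemma Msym_sym : (Msym R G S)^T = Msym R G S.
Proof.
by rewrite tr_block_mx tr_scalar_mx !linearZ /= trmxK loop_laplacian_sym.
Qed.

Lemma loop_vector_mul (w : 'rV[R]_n) :
  (w *m loop_vector R S) 0 0 = \sum_(i in S) w 0 i.
Proof.
rewrite mxE [RHS]big_mkcond; apply: eq_bigr => i _; rewrite mxE.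
by case: (i \in S); rewrite ?mulr1 ?mulr0.
Qed.

(** Expanding the squares, the terms in [a ^+ 2] sum to the corner entry
[2 * #|S|] and the cross terms to the off-diagonal blocks of [Msym]. *)
Lemma Msym_quadratic (a : R) (w : 'rV[R]_n)
    (v := row_mx a%:M w : 'rV[R]_(1 + n)) :
  (v *m Msym R G S *m v^T) 0 0 =
  (w *m laplacian R G *m w^T) 0 0 + \sum_(i in S) (w 0 i - Num.sqrt 2 * a) ^+ 2.
Proof.
set c := Num.sqrt 2; have cc : c ^+ 2 = 2 by rewrite sqr_sqrtr.
have sw : ((loop_vector R S)^T *m w^T) 0 0 = \sum_(i in S) w 0 i.
  by rewrite -trmx_mul mxE loop_vector_mul.
have -> : \sum_(i in S) (w 0 i - c * a) ^+ 2 = \sum_(i in S) w 0 i ^+ 2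
    - 2 * c * a * (\sum_(i in S) w 0 i) + 2 * a ^+ 2 * #|S|%:R.
  rewrite -[#|S|]sum1_card natr_sum !mulr_sumr -sumrB -big_split.
  by apply: eq_bigr => i _ /=; rewrite -[in X in X * 1]cc; ring.
rewrite /v mul_row_block tr_row_mx mul_row_col tr_scalar_mx !mulmxDl.
rewrite -!(scalemxAr, scalemxAl) !mul_scalar_mx !mul_mx_scalar.
rewrite -!(scalemxAr, scalemxAl).
have addE (A B : 'M[R]_1) : (A + B) 0 0 = A 0 0 + B 0 0 by rewrite mxE.
have scaleE b (A : 'M[R]_1) : (b *: A) 0 0 = b * A 0 0 by rewrite mxE.
rewrite !(addE, scaleE) sw loop_vector_mul loop_quadratic.
rewrite mxE eqxx mulr1n -/c; ring.
Qed.

End Quadratic.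

(** * Definiteness and kernels *)

Lemma gram_gt0 (R : realType) n (v : 'rV[R]_n) : v != 0 -> 0 < (v *m v^T) 0 0.
Proof.
move=> v0; rewrite lt_def; apply/andP; split.
  apply: contra_neq v0 => q0; apply: gram_eq0.
  by apply/matrixP => i j; rewrite !ord1 q0 mxE.
by rewrite mxE sumr_ge0 // => i _; rewrite mxE -expr2 sqr_ge0.
Qed.

Lemma row_unit_neq0 (F : fieldType) n (P : 'M[F]_n) i :
  P \in unitmx -> row i P != 0.
Proof.
move=> Pu; apply/eqP => r0; have /rowP/(_ i)/eqP : row i (P *m invmx P) = 0.
  by rewrite row_mul r0 mul0mx.
by rewrite mulmxV // !mxE eqxx oner_eq0.
Qed.

Lemma eigen_quadratic (R : realType) n (A P : 'M[R]_n) (d : 'rV[R]_n) i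
    (r := row i P) :
  P \in unitmx -> A = invmx P *m diag_mx d *m P ->
  (r *m A *m r^T) 0 0 = d 0 i * (r *m r^T) 0 0.
Proof.
move=> Pu eA; suff -> : r *m A = d 0 i *: r by rewrite -scalemxAl mxE.
rewrite /r -row_mul eA !mulmxA mulmxV // mul1mx.
by apply/rowP => j; rewrite mxE mul_diag_mx !mxE.
Qed.

Section Definiteness.
Variables (R : realType) (n : nat) (G : sgraph n) (S : {set 'I_n}).
Hypothesis hG : pseudo_connected G S.

Let sum_sqr_eq0 (f : 'I_n -> R) :
  \sum_(i in S) f i ^+ 2 = 0 -> forall i, i \in S -> f i = 0.
Proof.
move=> /eqP; rewrite psumr_eq0 => [/allP f0 i iS|i _]; last exact: sqr_ge0.
by move: (f0 i (mem_index_enum i)); rewrite iS sqrf_eq0 => /eqP.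
Qed.

Let laplacian_sum_sqr_eq0 (w : 'rV[R]_n) (f : 'I_n -> R) :
  (w *m laplacian R G *m w^T) 0 0 + \sum_(i in S) f i ^+ 2 = 0 ->
  (forall i j, connect G i j -> w 0 i = w 0 j) /\
  (forall i, i \in S -> f i = 0).
Proof.
move=> /eqP; rewrite paddr_eq0 ?laplacian_quadratic_ge0 //; last first.
  by rewrite sumr_ge0 // => i _; exact: sqr_ge0.
by case/andP => /eqP/laplacian_quadratic_eq0 wc /eqP/sum_sqr_eq0.
Qed.

(** A vector of zero energy is constant along paths and vanishes on the looped
vertices, one of which is reachable from every vertex. *)
Lemma loop_laplacian_pos (v : 'rV[R]_n) : v != 0 ->
  0 < (v *m loop_laplacian R G S *m v^T) 0 0.
Proof.
move=> v0; rewrite lt_def loop_quadratic; apply/andP; split; last first.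
  rewrite addr_ge0 ?laplacian_quadratic_ge0 ?sumr_ge0 // => i _.
  exact: sqr_ge0.
apply: contra_neq v0 => /laplacian_sum_sqr_eq0[vc vS].
apply/rowP => i; rewrite mxE.
by have [j jS /vc ->] := hG i; exact: vS.
Qed.

(** The constant function 1 on the lift, in the orthonormal even coordinates:
the coordinate of the middle vertex is 1 and that of each pair of copies is
[Num.sqrt 2]. *)
Definition Msym_kernel : 'rV[R]_(1 + n) := row_mx 1%:M (const_mx (Num.sqrt 2)).

Lemma Msym_kernel_neq0 : Msym_kernel != 0.
Proof.
apply/eqP => /rowP/(_ (lshift n 0)); rewrite row_mxEl !mxE eqxx => /eqP.
by rewrite oner_eq0.
Qed.

Lemma mul_Msym_kernel : Msym_kernel *m Msym R G S = 0.
Proof.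
rewrite mul_row_block !mul1mx -row_mx0.
have ss : Num.sqrt 2 * Num.sqrt 2 = 2 :> R by rewrite -expr2 sqr_sqrtr.
congr row_mx; apply/rowP => j.
  have scaleE b (A : 'M[R]_1) : (b *: A) 0 0 = b * A 0 0 by rewrite mxE.
  rewrite ord1 -scalemxAr mxE scaleE loop_vector_mul.
  rewrite (eq_bigr (fun=> Num.sqrt 2)) => [|i _]; last by rewrite mxE.
  rewrite !mxE eqxx mulr1n sumr_const.
  by rewrite mulNr !mulrnAr ss mulr1 subrr.
have lap0 : (const_mx (Num.sqrt 2) : 'rV[R]_n) *m laplacian R G = 0.
  apply/rowP => i; rewrite mul_laplacian [RHS]mxE big1 // => k _.
  by rewrite !mxE subrr mulr0.
by rewrite /loop_laplacian mulmxDr lap0 add0r mul_mx_diag !mxE mulNr addNr.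
Qed.

Lemma Msym_quadraticE (v : 'rV[R]_(1 + n)) (a := v 0 (lshift n 0)) :
  (v *m Msym R G S *m v^T) 0 0 =
  (rsubmx v *m laplacian R G *m (rsubmx v)^T) 0 0 +
    \sum_(i in S) (rsubmx v 0 i - Num.sqrt 2 * a) ^+ 2.
Proof.
have -> : v = row_mx a%:M (rsubmx v).
  rewrite -{1}[v]hsubmxK; congr row_mx.
  by apply/rowP => i; rewrite !ord1 !mxE eqxx.
by rewrite Msym_quadratic row_mxKr.
Qed.

Lemma Msym_quadratic_ge0 (v : 'rV[R]_(1 + n)) :
  0 <= (v *m Msym R G S *m v^T) 0 0.
Proof.
rewrite Msym_quadraticE addr_ge0 ?laplacian_quadratic_ge0 ?sumr_ge0 // => i _.
exact: sqr_ge0.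
Qed.

Lemma Msym_quadratic_eq0 (v : 'rV[R]_(1 + n)) :
  (v *m Msym R G S *m v^T) 0 0 = 0 -> exists a, v = a *: Msym_kernel.
Proof.
rewrite Msym_quadraticE => /laplacian_sum_sqr_eq0[vc vS].
exists (v 0 (lshift n 0)); rewrite -{1}[v]hsubmxK scale_row_mx.
congr row_mx; apply/rowP => i.
  by rewrite ord1 !mxE eqxx mulr1.
have [j jS /vc ->] := hG i.
by move/eqP: (vS j jS); rewrite subr_eq0 => /eqP ->; rewrite !mxE mulrC.
Qed.

Lemma loop_laplacian_spectrum_gt0 (P : 'M[R]_n) d : P \in unitmx ->
  loop_laplacian R G S = invmx P *m diag_mx d *m P -> forall i, 0 < d 0 i.
Proof.
move=> Pu eA i; have r0 := row_unit_neq0 i Pu.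
have := loop_laplacian_pos r0; rewrite (eigen_quadratic _ Pu eA).
by rewrite pmulr_lgt0 // gram_gt0.
Qed.

(** The rows of [P] are eigenvectors, so the entries of [d] are nonnegative by
positivity of the quadratic form, and the rows of eigenvalue zero are multiples
of [Msym_kernel].  Some entry vanishes because [Msym] is singular; two would
make two rows of [P] proportional. *)
Lemma Msym_spectrum (P : 'M[R]_(1 + n)) d : P \in unitmx ->
  Msym R G S = invmx P *m diag_mx d *m P ->
  exists2 i0, d 0 i0 = 0 & forall i, (0 < d 0 i) = (i != i0).
Proof.
move=> Pu eA.
have dker i : d 0 i = 0 -> exists2 a, a != 0 & row i P = a *: Msym_kernel.
  move=> di0; have [|a ra] := @Msym_quadratic_eq0 (row i P).
    by rewrite (eigen_quadratic _ Pu eA) di0 mul0r.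
  exists a => //; apply: contra_neq (row_unit_neq0 i Pu) => a0.
  by rewrite ra a0 scale0r.
have [i0 di0] : exists i0, d 0 i0 = 0.
  pose c := Msym_kernel *m invmx P.
  have /rV0Pn[i0 ci0] : c != 0.
    apply: contra_neq Msym_kernel_neq0 => c0.
    by rewrite -[Msym_kernel](mulmxKV Pu) -/c c0 mul0mx.
  have /rowP/(_ i0) : c *m diag_mx d = 0.
    rewrite -[LHS](mulmxK Pu) [X in X *m _](_ : _ = 0) ?mul0mx //.
    by rewrite -[RHS]mul_Msym_kernel eA !mulmxA.
  rewrite mul_mx_diag !mxE => /eqP; rewrite mulf_eq0 => /orP[/eqP c0|/eqP];
    last by exists i0.
  by move: ci0; rewrite mxE c0 eqxx.
exists i0 => // i; have [->|ii0] := eqVneq i i0; first by rewrite di0 ltxx.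
rewrite lt_def; apply/andP; split; last first.
  rewrite -(pmulr_lge0 _ (gram_gt0 (row_unit_neq0 i Pu))).
  by rewrite -(eigen_quadratic _ Pu eA) Msym_quadratic_ge0.
apply/eqP => /dker[a a0 ri]; have [b b0 ri0] := dker i0 di0.
have : (b *: row i P - a *: row i0 P) *m invmx P = 0.
  by rewrite ri ri0 !scalerA mulrC subrr mul0mx.
rewrite mulmxBl -!scalemxAl -!row_mul mulmxV // => /rowP/(_ i).
rewrite !mxE eqxx (eq_sym i0) (negPf ii0) mulr1 mulr0 subr0 => /eqP.
by rewrite (negPf b0).
Qed.

End Definiteness.

(** * The lift and its involution *)

Section LiftAdjacency.
Variables (n : nat) (G : sgraph n) (S : {set 'I_n}).

Lemma eq_copy1 (i j : 'I_n) : (copy1 i == copy1 j) = (i == j).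
Proof. exact: (inj_eq (@lshift_inj _ _)). Qed.

Lemma eq_copy2 (i j : 'I_n) : (copy2 i == copy2 j) = (i == j).
Proof. by rewrite (inj_eq (@rshift_inj _ _)) (inj_eq (@rshift_inj _ _)). Qed.

Lemma eq_copy12 (i j : 'I_n) : (copy1 i == copy2 j) = false.
Proof. exact: eq_lrshift. Qed.

Lemma eq_copy21 (i j : 'I_n) : (copy2 i == copy1 j) = false.
Proof. exact: eq_rlshift. Qed.

Lemma eq_copy1m (i : 'I_n) : (copy1 i == midv n) = false.
Proof. exact: eq_lrshift. Qed.

Lemma eq_mcopy1 (i : 'I_n) : (midv n == copy1 i) = false.
Proof. exact: eq_rlshift. Qed.

Lemma eq_copy2m (i : 'I_n) : (copy2 i == midv n) = false.
Proof. by rewrite (inj_eq (@rshift_inj _ _)) eq_rlshift. Qed.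

Lemma eq_mcopy2 (i : 'I_n) : (midv n == copy2 i) = false.
Proof. by rewrite (inj_eq (@rshift_inj _ _)) eq_lrshift. Qed.

Let eq_lift := (eq_copy1, eq_copy2, eq_copy12, eq_copy21, eq_copy1m,
  eq_mcopy1, eq_copy2m, eq_mcopy2, eqxx, andbF, andbT, orbF, orFb).

(** The definition of [lift_adj] quantifies over witnesses; the facts below
evaluate these quantifiers once the equalities between vertices of the lift
have been decided. *)
Let adj_ex (i j : 'I_n) :
  [exists a, exists b, G a b && ((i == a) && (j == b) || (i == b) && (j == a))]
  = G i j.
Proof.
apply/idP/idP.
  case/existsP=> a /existsP[b /andP[Gab]].
  by case/orP=> /andP[/eqP -> /eqP ->]; rewrite // adj_sym.
move=> Gij; apply/existsP; exists i; apply/existsP; exists j.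
by rewrite Gij !eqxx.
Qed.

Let mem_ex (i : 'I_n) : [exists a in S, i == a] = (i \in S).
Proof.
apply/existsP/idP => [[a /andP[aS /eqP ->]] //|iS].
by exists i; rewrite iS eqxx.
Qed.

Let ex2F : [exists a : 'I_n, exists b : 'I_n, G a b && false] = false.
Proof. by apply/existsP => -[a /existsP[b]]; rewrite andbF. Qed.

Let exF : [exists a in S, false] = false.
Proof. by apply/existsP => -[a]; rewrite andbF. Qed.

Let simpl_ex (P P' : 'I_n -> 'I_n -> bool) (Q Q' : 'I_n -> bool) :
  P =2 P' -> Q =1 Q' ->
  [exists a, exists b, P a b] || [exists a in S, Q a] =
  [exists a, exists b, P' a b] || [exists a in S, Q' a].
Proof.
move=> eP eQ; congr (_ || _).
  by apply: eq_existsb => a; apply: eq_existsb.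
by apply: eq_existsb => a; rewrite eQ.
Qed.

Lemma lift_copy11 i j : lift_adj G S (copy1 i) (copy1 j) = G i j.
Proof.
rewrite /lift_adj /link (@simpl_ex _ _ _ xpred0 (fun a b => erefl _)).
  rewrite exF orbF -[RHS]adj_ex.
  by do 2!(apply: eq_existsb => ?); rewrite !eq_lift.
by move=> a; rewrite !eq_lift.
Qed.

Lemma lift_copy22 i j : lift_adj G S (copy2 i) (copy2 j) = G i j.
Proof.
rewrite /lift_adj /link (@simpl_ex _ _ _ xpred0 (fun a b => erefl _)).
  rewrite exF orbF -[RHS]adj_ex.
  by do 2!(apply: eq_existsb => ?); rewrite !eq_lift.
by move=> a; rewrite !eq_lift.
Qed.

Lemma lift_copy12 i j : lift_adj G S (copy1 i) (copy2 j) = false.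
Proof.
rewrite /lift_adj /link (@simpl_ex _ (fun a b => G a b && false) _ xpred0).
- by rewrite exF ex2F.
- by move=> a b; rewrite !eq_lift.
- by move=> a; rewrite !eq_lift.
Qed.

Lemma lift_copy1m i : lift_adj G S (copy1 i) (midv n) = (i \in S).
Proof.
rewrite /lift_adj /link (@simpl_ex _ (fun a b => G a b && false) _
  (fun a => i == a)).
- by rewrite mem_ex ex2F.
- by move=> a b; rewrite !eq_lift.
- by move=> a; rewrite !eq_lift.
Qed.

Lemma lift_copy2m i : lift_adj G S (copy2 i) (midv n) = (i \in S).
Proof.
rewrite /lift_adj /link (@simpl_ex _ (fun a b => G a b && false) _
  (fun a => i == a)).
- by rewrite mem_ex ex2F.
- by move=> a b; rewrite !eq_lift.
- by move=> a; rewrite !eq_lift.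
Qed.

End LiftAdjacency.

Section Block3.
Variables (T : pzRingType) (n : nat).

(** Matrices indexed by the vertices of the lift, cut into first copy, middle
vertex and second copy. *)
Definition block3 (A11 : 'M[T]_n) (A12 : 'cV[T]_n) (A13 : 'M[T]_n)
    (A21 : 'rV[T]_n) (A22 : 'M[T]_1) (A23 : 'rV[T]_n)
    (A31 : 'M[T]_n) (A32 : 'cV[T]_n) (A33 : 'M[T]_n) : 'M[T]_(n + (1 + n)) :=
  block_mx A11 (row_mx A12 A13) (col_mx A21 A31) (block_mx A22 A23 A32 A33).

Lemma block3E A11 A12 A13 A21 A22 A23 A31 A32 A33
    (M := block3 A11 A12 A13 A21 A22 A23 A31 A32 A33) :
  ((forall i j, M (copy1 i) (copy1 j) = A11 i j) *
   (forall i, M (copy1 i) (midv n) = A12 i 0) *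
   (forall i j, M (copy1 i) (copy2 j) = A13 i j) *
   (forall j, M (midv n) (copy1 j) = A21 0 j) *
   (M (midv n) (midv n) = A22 0 0) *
   (forall j, M (midv n) (copy2 j) = A23 0 j) *
   (forall i j, M (copy2 i) (copy1 j) = A31 i j) *
   (forall i, M (copy2 i) (midv n) = A32 i 0) *
   (forall i j, M (copy2 i) (copy2 j) = A33 i j))%type.
Proof.
by do !split; intros; rewrite /M /copy1 /copy2 /midv !(block_mxEul, block_mxEur,
  block_mxEdl, block_mxEdr, row_mxEl, row_mxEr, col_mxEu, col_mxEd).
Qed.

Lemma mul_block3 A11 A12 A13 A21 A22 A23 A31 A32 A33
    B11 B12 B13 B21 B22 B23 B31 B32 B33 :
  block3 A11 A12 A13 A21 A22 A23 A31 A32 A33 *m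
  block3 B11 B12 B13 B21 B22 B23 B31 B32 B33 =
  block3 (A11 *m B11 + (A12 *m B21 + A13 *m B31))
         (A11 *m B12 + (A12 *m B22 + A13 *m B32))
         (A11 *m B13 + (A12 *m B23 + A13 *m B33))
         (A21 *m B11 + (A22 *m B21 + A23 *m B31))
         (A21 *m B12 + (A22 *m B22 + A23 *m B32))
         (A21 *m B13 + (A22 *m B23 + A23 *m B33))
         (A31 *m B11 + (A32 *m B21 + A33 *m B31))
         (A31 *m B12 + (A32 *m B22 + A33 *m B32))
         (A31 *m B13 + (A32 *m B23 + A33 *m B33)).
Proof.
rewrite /block3 mulmx_block mul_row_col mul_mx_row mul_row_block add_row_mx.
by rewrite mul_col_mx mul_block_col add_col_mx mul_col_row mulmx_block add_block_mx.
Qed.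

Lemma tr_block3 A11 A12 A13 A21 A22 A23 A31 A32 A33 :
  (block3 A11 A12 A13 A21 A22 A23 A31 A32 A33)^T =
  block3 A11^T A21^T A31^T A12^T A22^T A32^T A13^T A23^T A33^T.
Proof. by rewrite /block3 !(tr_block_mx, tr_row_mx, tr_col_mx). Qed.

Lemma block3_1 : block3 1%:M 0 0 0 1%:M 0 0 0 1%:M = 1%:M.
Proof. by rewrite /block3 row_mx0 col_mx0 -!scalar_mx_block. Qed.

End Block3.

Section LiftSpectrum.
Variables (R : realType) (n : nat) (G : sgraph n) (S : {set 'I_n}).
Let L := loop_laplacian R G S.
Let s := loop_vector R S.

Let loopE i j :
  L i j = (i == j)%:R * (\sum_k (G i k)%:R + (i \in S)%:R) - (G i j)%:R.
Proof.
rewrite mulrDr addrAC -laplacianE mxE; congr (_ + _).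
by rewrite !mxE -[LHS]mulr_natl; case: eqP => [->|]; rewrite ?mul0r.
Qed.

Let lift21 i j : lift_adj G S (copy2 i) (copy1 j) = false.
Proof. by rewrite lift_adj_sym lift_copy12. Qed.

Let liftm1 i : lift_adj G S (midv n) (copy1 i) = (i \in S).
Proof. by rewrite lift_adj_sym lift_copy1m. Qed.

Let liftm2 i : lift_adj G S (midv n) (copy2 i) = (i \in S).
Proof. by rewrite lift_adj_sym lift_copy2m. Qed.

Let sum_lift (F : 'I_(n + (1 + n)) -> R) :
  \sum_u F u = \sum_i F (copy1 i) + (F (midv n) + \sum_i F (copy2 i)).
Proof. by rewrite !big_split_ord big_ord1. Qed.

Let degree1 i : \sum_w (lift_adj G S (copy1 i) w)%:R =
  \sum_j (G i j)%:R + (i \in S)%:R :> R.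
Proof.
rewrite sum_lift lift_copy1m [X in _ + (_ + X)]big1 ?addr0 => [|j _]; last first.
  by rewrite lift_copy12.
by congr (_ + _); apply: eq_bigr => j _; rewrite lift_copy11.
Qed.

Let degree2 i : \sum_w (lift_adj G S (copy2 i) w)%:R =
  \sum_j (G i j)%:R + (i \in S)%:R :> R.
Proof.
rewrite sum_lift lift_copy2m big1 ?add0r => [|j _]; last by rewrite lift21.
by rewrite addrC; congr (_ + _); apply: eq_bigr => j _; rewrite lift_copy22.
Qed.

Let degreem : \sum_w (lift_adj G S (midv n) w)%:R = 2 * #|S|%:R :> R.
Proof.
have sumS (F : 'I_n -> bool) : (forall i, F i = (i \in S)) ->
    \sum_i (F i)%:R = #|S|%:R :> R.
  move=> FS; rewrite -sum1_card natr_sum [RHS]big_mkcond.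
  by apply: eq_bigr => i _; rewrite FS; case: (i \in S).
by rewrite sum_lift lift_adj_irrefl !sumS // add0r -mulr2n mulr_natl.
Qed.

Let lift_laplacianE u v : laplacian R (acikmese_lift G S) u v =
  (u == v)%:R * (\sum_w (lift_adj G S u w)%:R) - (lift_adj G S u v)%:R.
Proof. exact: laplacianE. Qed.

Let lift_ind (P : 'I_(n + (1 + n)) -> Prop) :
  (forall i, P (copy1 i)) -> P (midv n) -> (forall i, P (copy2 i)) ->
  forall u, P u.
Proof.
move=> P1 Pm P2 u; rewrite -(splitK u); case: (fintype.split u) => [//|u'] /=.
rewrite -(splitK u'); case: (fintype.split u') => [k|i] /=; last exact: P2.
by rewrite (ord1 k).
Qed.

Lemma lift_laplacian_block :
  laplacian R (acikmese_lift G S) =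
  block3 L (- s) 0 (- s^T) (2 * #|S|%:R)%:M (- s^T) 0 (- s) L.
Proof.
apply/matrixP; elim/lift_ind => [i||i]; elim/lift_ind => [j||j];
  rewrite lift_laplacianE block3E.
- by rewrite eq_copy1 degree1 lift_copy11 loopE.
- by rewrite eq_copy1m lift_copy1m mul0r sub0r !mxE.
- by rewrite eq_copy12 lift_copy12 mul0r sub0r oppr0 mxE.
- by rewrite eq_mcopy1 liftm1 mul0r sub0r !mxE.
- by rewrite eqxx degreem lift_adj_irrefl mul1r subr0 mxE eqxx mulr1n.
- by rewrite eq_mcopy2 liftm2 mul0r sub0r !mxE.
- by rewrite eq_copy21 lift21 mul0r sub0r oppr0 mxE.
- by rewrite eq_copy2m lift_copy2m mul0r sub0r !mxE.
- by rewrite eq_copy2 degree2 lift_copy22 loopE.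
Qed.

Lemma involution_block : involution_mx n R =
  block3 0 0 1%:M 0 1%:M 0 1%:M 0 0.
Proof.
have swap1 i : swap_perm n (copy1 i) = copy2 i.
  by rewrite permE /swap_fun (unsplitK (inl i)).
have swap2 i : swap_perm n (copy2 i) = copy1 i.
  by rewrite -swap1 permE permE swap_funK.
have swapm : swap_perm n (midv n) = midv n.
  by rewrite permE /swap_fun (unsplitK (inr _)) (unsplitK (inl _)).
apply/matrixP; elim/lift_ind => [i||i]; elim/lift_ind => [j||j];
  by rewrite block3E !mxE ?(swap1, swap2, swapm) ?(eq_copy1, eq_copy2, eq_copy12,
    eq_copy21, eq_copy1m, eq_mcopy1, eq_copy2m, eq_mcopy2, eqxx).
Qed.

Let a : R := (Num.sqrt 2)^-1.

(** The rows are the orthonormal basis adapted to the involution: the odd vectors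
[(e_i - e_i') / sqrt 2], then the middle vertex, then the even vectors
[(e_i + e_i') / sqrt 2]. *)
Definition parity_mx : 'M[R]_(n + (1 + n)) :=
  block3 a%:M 0 (- a)%:M 0 1%:M 0 a%:M 0 a%:M.

Let aa : a * a + a * a = 1.
Proof. by rewrite /a -invfM -expr2 sqr_sqrtr //; field. Qed.

Let sqrt2a : Num.sqrt 2 * a = 1.
Proof. by rewrite mulfV // gt_eqF // sqrtr_gt0. Qed.

Let mulE := (mulmx0, mul0mx, addr0, add0r, mul1mx, mulmx1, mul_scalar_mx,
  mul_mx_scalar, scaler0, scale_scalar_mx).

Lemma parity_mx_unit : parity_mx \in unitmx.
Proof.
suff /mulmx1_unit[] : parity_mx *m parity_mx^T = 1%:M by [].
rewrite /parity_mx tr_block3 !tr_scalar_mx !trmx0 mul_block3 !mulE -!raddfD /=.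
by rewrite mulrNN mulrN mulNr aa subrr raddf0 block3_1.
Qed.

Lemma block_diag3 (A : 'M[R]_n) (B : 'M[R]_(1 + n)) :
  block_mx A 0 0 B =
  block3 A 0 0 0 (ulsubmx B) (ursubmx B) 0 (dlsubmx B) (drsubmx B).
Proof. by rewrite /block3 row_mx0 col_mx0 submxK. Qed.

Lemma parity_lift_laplacian :
  parity_mx *m laplacian R (acikmese_lift G S) =
  block_mx L 0 0 (Msym R G S) *m parity_mx.
Proof.
rewrite lift_laplacian_block block_diag3 /Msym.
rewrite block_mxKul block_mxKur block_mxKdl block_mxKdr -/L -/s.
rewrite /parity_mx !mul_block3 !mulE.
have as1 : a * Num.sqrt 2 = 1 by rewrite mulrC.
have a2 : a + a = Num.sqrt 2.
  have := congr1 ( *%R (Num.sqrt 2)) aa.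
  by rewrite mulrDr !mulrA sqrt2a !mul1r mulr1.
congr block3.
- by rewrite scaleNr scalerN opprK addNr.
- by rewrite scalerA mulrN as1 scaleN1r.
- by rewrite scalerA mulrN as1 scaleN1r.
- by rewrite -scalerDl a2 scalerN scaleNr.
Qed.

Lemma parity_involution :
  parity_mx *m involution_mx n R = block_mx (-1)%:M 0 0 1%:M *m parity_mx.
Proof.
have one_block : (1%:M : 'M[R]_(1 + n)) = block_mx 1%:M 0 0 1%:M.
  exact: scalar_mx_block.
rewrite involution_block block_diag3 one_block.
rewrite block_mxKul block_mxKur block_mxKdl block_mxKdr.
by rewrite /parity_mx !mul_block3 !mulE mulrN !mulN1r opprK.
Qed.

(** Diagonalizing the two diagonal blocks diagonalizes the Laplacian of the lift
in a basis where the involution still acts by -1 on the first [n] coordinates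
and by 1 on the others. *)
Lemma equivariant_heat_trace_spectrum (t : R) (P1 : 'M[R]_n) d1
    (P2 : 'M[R]_(1 + n)) d2 :
  P1 \in unitmx -> L = invmx P1 *m diag_mx d1 *m P1 ->
  P2 \in unitmx -> Msym R G S = invmx P2 *m diag_mx d2 *m P2 ->
  equivariant_heat_trace G S t =
  \sum_j expR (- t * d2 0 j) - \sum_i expR (- t * d1 0 i).
Proof.
move=> P1u e1 P2u e2; pose B := block_mx P1 0 0 P2; pose P := B *m parity_mx.
have Pu : P \in unitmx.
  rewrite unitmx_mul parity_mx_unit andbT unitmxE det_ublock unitrM -!unitmxE.
  by rewrite P1u.
have PL : - t *: laplacian R (acikmese_lift G S) =
    invmx P *m diag_mx (- t *: row_mx d1 d2) *m P.
  rewrite -mulmxA; apply: (canRL (mulKmx Pu)).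
  rewrite -scalemxAr linearZ /= -scalemxAl; congr (_ *: _).
  rewrite /P -mulmxA parity_lift_laplacian !mulmxA; congr (_ *m _).
  rewrite diag_mx_row !mulmx_block !(mul0mx, mulmx0, addr0, add0r).
  by rewrite e1 e2 !mulmxA !mulmxV // !mul1mx.
have PT : P *m involution_mx n R = block_mx (-1)%:M 0 0 1%:M *m P.
  rewrite /P -mulmxA parity_involution !mulmxA; congr (_ *m _).
  rewrite !mulmx_block !(mul0mx, mulmx0, addr0, add0r, mul1mx, mulmx1).
  by rewrite scalar_mxC.
clearbody P; rewrite /equivariant_heat_trace (expmx_similar_diag Pu PL) -!mulmxA PT.
rewrite mxtrace_mulC !mulmxA mulmxK //.
rewrite scale_row_mx map_row_mx diag_mx_row mulmx_block.
rewrite !(mul0mx, mulmx0, addr0, add0r, mulmx1) mul_mx_scalar mxtrace_block.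
rewrite mxtraceZ !mxtrace_diag mulN1r addrC.
by congr (_ - _); apply: eq_bigr => i _; rewrite !mxE.
Qed.

End LiftSpectrum.

(** * The regularized heat integral *)

Theorem theorem5p22 (R : realType) (N : nat) (G : sgraph N) (S : {set 'I_N})
    (hS : (1 <= #|S|)%N) (hG : pseudo_connected G S)
    (nu lambda : seq R)
    (hnu : lists_eigenvalues (Msym R G S) (fun x : R => 0 < x) nu)
    (hlambda : lists_eigenvalues (loop_laplacian R G S) predT lambda) :
  [/\ size nu = N, size lambda = N,
      heat_integral R G S =
        (\sum_(x <- nu) x^-1 - \sum_(x <- lambda) x^-1)%:E
    & heat_integral R G S =
        (\tr (moore_penrose (Msym R G S))
         - \tr (invmx (loop_laplacian R G S)))%:E].
Proof.
have [P1 [d1 P1u e1]] := symmetric_diagonalizable (loop_laplacian_sym R G S).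
have [P2 [d2 P2u e2]] := symmetric_diagonalizable (Msym_sym R G S).
have d1_gt0 := loop_laplacian_spectrum_gt0 hG P1u e1.
have [i0 d2i0 d2_gt0] := Msym_spectrum hG P2u e2.
have plam := lists_eigenvalues_diag P1u e1 hlambda.
have pnu := lists_eigenvalues_diag P2u e2 hnu.
have sum_lam (F : R -> R) : \sum_i F (d1 0 i) = \sum_(x <- lambda) F x.
  by rewrite (sum_eigenvalues _ plam).
(* The single zero eigenvalue of [Msym] is missing from [nu]. *)
have sum_nu (F : R -> R) : \sum_j F (d2 0 j) = F 0 + \sum_(x <- nu) F x.
  rewrite (bigD1 i0) //= d2i0 (sum_eigenvalues _ pnu); congr (_ + _).
  by apply: eq_bigl => j; rewrite d2_gt0.
have lam_gt0 : all (> 0) lambda.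
  rewrite (perm_all _ plam) filter_predT; apply/allP => _ /mapP[i _ ->].
  exact: d1_gt0.
have nu_gt0 : all (> 0) nu by rewrite (perm_all _ pnu) filter_all.
have heatE : heat_integral R G S =
    (\sum_(x <- nu) x^-1 - \sum_(x <- lambda) x^-1)%:E.
  have [int_nu eq_nu] := integral_heat_sum nu_gt0.
  have [int_lam eq_lam] := integral_heat_sum lam_gt0.
  rewrite EFinB -eq_nu -eq_lam -integralB //.
  apply: eq_integral => t _; rewrite -EFinB; congr (_%:E).
  rewrite (equivariant_heat_trace_spectrum t P1u e1 P2u e2).
  rewrite (sum_nu (fun x => expR (- t * x))).
  rewrite (sum_lam (fun x => expR (- t * x))).
  by rewrite mulr0 expR0 /heat_sum; ring.
have inv_gi :
    group_inverse (loop_laplacian R G S) (invmx (loop_laplacian R G S)).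
  have Lu : loop_laplacian R G S \in unitmx.
    rewrite e1 !unitmx_mul unitmx_inv P1u andbT /= unitmxE det_diag unitfE.
    by apply/prodf_neq0 => i _; rewrite gt_eqF.
  by split; rewrite ?mulmxV ?mulVmx ?mul1mx.
split=> //.
- by rewrite (size_eigenvalues pnu) (eq_card (B := predC1 i0)) ?cardC1 ?card_ord.
- by rewrite (size_eigenvalues plam) -[RHS](card_ord N); apply: eq_card.
- rewrite heatE (trace_group_inverse_diag P1u e1 inv_gi).
  have mp_gi := moore_penrose_group_inverse (Msym_sym R G S).
  rewrite (trace_group_inverse_diag P2u e2 mp_gi).
  by rewrite (sum_nu GRing.inv) (sum_lam GRing.inv) invr0 add0r.
Qed.
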